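(* Let $d\ge1$. For $\alpha\in(1,2)$ let $\mu_\alpha$ be the ergodic measure of the solution of the $\mathbb{R}^d$-valued SDE $\mathrm{d}X_t=-X_t\,\mathrm{d}t+\mathrm{d}L_t$, where $L_t$ is the rotationally symmetric $\alpha$-stable Lévy process with $\mathbb{E}\,e^{i\langle\xi,L_t\rangle}=e^{-t|\xi|^\alpha/2}$, and let $\mu_2$ be the ergodic measure of the solution of $\mathrm{d}Y_t=-Y_t\,\mathrm{d}t+\mathrm{d}B_t$, where $B_t$ is a standard $d$-dimensional Brownian motion. Then there exists a constant $C_d>0$ depending only on $d$ such that for every $\alpha\in(1,2)$, $$W_1(\mu_\alpha,\mu_2)\ge C_d\,(2-\alpha).$$
   Context: The ergodic measure is the unique invariant probability measure of the (ergodic) Markov process. The Wasserstein-1 distance is $W_1(\mu,\nu)=\sup\{\int h\,\mathrm{d}\mu-\int h\,\mathrm{d}\nu : h:\mathbb{R}^d\to\mathbb{R},\ |h(x)-h(y)|\le|x-y|\ \forall x,y\}$, equivalently the infimum of $\iint|x-y|\,\Pi(\mathrm{d}x,\mathrm{d}y)$ over all couplings $\Pi$ of $\mu$ and $\nu$. *)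

(* Defs.v *)
From HB Require Import structures.
From mathcomp Require Import all_boot all_order all_algebra.
From mathcomp Require Import all_classical all_reals all_analysis.

Set Implicit Arguments.
Unset Strict Implicit.
Unset Printing Implicit Defensive.

Import Order.TTheory GRing.Theory Num.Theory.
Import numFieldNormedType.Exports.

Local Open Scope classical_set_scope.
Local Open Scope ring_scope.

(* The space R^d is 'rV[R]_d, equipped with its Borel sigma-algebra. *)
HB.instance Definition _ (R : realType) (d : nat) :=
  Measurable.copy 'rV[R]_d (g_sigma_algebraType (@open 'rV[R]_d)).

(* The library's norm on 'rV[R]_d is the sup norm, hence [enorm]. *)
Definition dotp (R : realType) (d : nat) (x y : 'rV[R]_d) : R :=
  \sum_(i < d) x 0 i * y 0 i.

Definition enorm (R : realType) (d : nat) (x : 'rV[R]_d) : R :=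
  Num.sqrt (dotp x x).

Definition W1 (R : realType) (d : nat) (mu nu : probability 'rV[R]_d R) :
    \bar R :=
  ereal_sup [set (\int[mu]_x (h x)%:E - \int[nu]_x (h x)%:E)%E |
    h in [set h : 'rV[R]_d -> R |
      forall x y, `|h x - h y| <= enorm (x - y)]].

(* Processes are indexed by R; only times t >= 0 are meaningful. *)
Definition cadlag (R : realType) (d : nat) (f : R -> 'rV[R]_d) : Prop :=
  (forall t, 0 <= t -> f s @[s --> t^'+] --> f t) /\
  (forall t, 0 < t -> cvg (f s @[s --> t^'-])).

(* Mutual independence; the choice A k = setT covers the subfamilies. *)
Definition independent_family (dO : measure_display) (Om : measurableType dO)
    (R : realType) (P : probability Om R) (d n : nat)
    (Z : 'I_n -> Om -> 'rV[R]_d) : Prop :=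
  forall A : 'I_n -> set 'rV[R]_d, (forall k, measurable (A k)) ->
    P [set w | forall k, A k (Z k w)]
    = (\prod_(k < n) P [set w | A k (Z k w)])%E.

Definition independent_increments (dO : measure_display)
    (Om : measurableType dO) (R : realType) (P : probability Om R) (d : nat)
    (L : R -> Om -> 'rV[R]_d) : Prop :=
  forall (n : nat) (t : nat -> R),
    0 <= t 0%N -> (forall k, t k <= t k.+1) ->
    independent_family P (fun (k : 'I_n) w => L (t k.+1) w - L (t k) w).

Record levy_process (dO : measure_display) (Om : measurableType dO)
    (R : realType) (P : probability Om R) (d : nat)
    (L : R -> Om -> 'rV[R]_d) : Prop := LevyProcess {
  levy_measurable : forall t, 0 <= t -> measurable_fun setT (L t);
  levy_start : {ae P, forall w, L 0 w = 0};
  levy_indep : independent_increments P L;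
  levy_stationary : forall s t, 0 <= s -> s <= t ->
    forall A, measurable A ->
      P [set w | A (L t w - L s w)] = P [set w | A (L (t - s) w)];
  levy_cadlag : {ae P, forall w, cadlag (fun t => L t w)} }.

(* E exp(i <xi, L_t>) = exp(- t |xi|^alpha / 2), split into its real and
   imaginary parts. *)
Definition stable_levy_process (dO : measure_display) (Om : measurableType dO)
    (R : realType) (P : probability Om R) (d : nat) (alpha : R)
    (L : R -> Om -> 'rV[R]_d) : Prop :=
  levy_process P L /\
  forall (t : R) (xi : 'rV[R]_d), 0 <= t ->
    ('E_P[fun w => cos (dotp xi (L t w))]
       = (expR (- (t * (enorm xi `^ alpha) / 2)))%:E)%E /\
    ('E_P[fun w => sin (dotp xi (L t w))] = 0)%E.

Record brownian_motion (dO : measure_display) (Om : measurableType dO)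
    (R : realType) (P : probability Om R) (d : nat)
    (B : R -> Om -> 'rV[R]_d) : Prop := BrownianMotion {
  bm_measurable : forall t, 0 <= t -> measurable_fun setT (B t);
  bm_start : {ae P, forall w, B 0 w = 0};
  bm_indep : independent_increments P B;
  (* B_t - B_s has law N(0, (t - s) I_d); the second parameter of
     [normal_prob] is the standard deviation. *)
  bm_gaussian : forall s t, 0 <= s -> s < t ->
    forall A : 'I_d -> set (measurableTypeR R), (forall i, measurable (A i)) ->
      P [set w | forall i, A i ((B t w - B s w) 0 i)]
      = (\prod_(i < d) normal_prob 0 (Num.sqrt (t - s)) (A i))%E;
  bm_continuous :
    {ae P, forall w, {within `[0%R, +oo[, continuous (fun t => B t w)}} }.

(* X solves dX_t = - X_t dt + dL_t, X_0 = x. The noise is additive, so the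
   equation is the pathwise identity X_t = x - \int_0^t X_s ds + L_t. *)
Definition ou_solution (dO : measure_display) (Om : measurableType dO)
    (R : realType) (P : probability Om R) (d : nat)
    (L : R -> Om -> 'rV[R]_d) (x : 'rV[R]_d) (X : R -> Om -> 'rV[R]_d) : Prop :=
  [/\ forall t, 0 <= t -> measurable_fun setT (X t),
      {ae P, forall w, cadlag (fun t => X t w)} &
      {ae P, forall w, forall t, 0 <= t -> forall i : 'I_d,
        lebesgue_measure.-integrable `[0, t] (fun s => (X s w 0 i)%:E) /\
        X t w 0 i =
          x 0 i - (\int[lebesgue_measure]_(s in `[0, t]) X s w 0 i)
          + L t w 0 i}].

(* [X x] is the process started at x, with transition probabilities
   P_t(x, A) = P (X x t \in A). *)
Definition invariant_measure (dO : measure_display) (Om : measurableType dO)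
    (R : realType) (P : probability Om R) (d : nat)
    (X : 'rV[R]_d -> R -> Om -> 'rV[R]_d) (mu : probability 'rV[R]_d R) :
    Prop :=
  forall t, 0 <= t -> forall A : set 'rV[R]_d, measurable A ->
    (\int[mu]_x P [set w | A (X x t w)] = mu A)%E.

Definition ergodic_measure (dO : measure_display) (Om : measurableType dO)
    (R : realType) (P : probability Om R) (d : nat)
    (X : 'rV[R]_d -> R -> Om -> 'rV[R]_d) (mu : probability 'rV[R]_d R) :
    Prop :=
  invariant_measure P X mu /\
  forall nu : probability 'rV[R]_d R, invariant_measure P X nu ->
    forall A : set 'rV[R]_d, measurable A -> nu A = mu A.

(* Main.v *)
(* Test W1 against h(x) = - cos x_0, which is 1-Lipschitz. Since the noise is
   additive, X^x_t = e^{-t} x + Z_t with Z_t = X^0_t, so an invariant law mu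
   satisfies
     int cos(x_0) dmu = E[cos(Z_t)_0] int cos(e^{-t} x_0) dmu,
   and t -> oo gives int cos(x_0) dmu = lim_t E[cos(Z_t)_0]. The implicit Euler
   scheme with step h = t/n writes (Z_t)_0 as an almost sure limit of
   combinations sum_k (1 + h)^{k-n} (L_{(k+1)h} - L_{kh})_0 of independent
   increments, whose Fourier transform is explicit; its limit is
   exp(- (1 - e^{- alpha t}) / (2 alpha)). Hence int cos(x_0) dmu_alpha =
   exp(- 1 / (2 alpha)), Brownian motion being the case alpha = 2, and
   exp(- 1/4) - exp(- 1 / (2 alpha)) >= e^{-1/2} (2 - alpha) / 8.

   A real law symmetric about 0 with Fourier transform psi at 1 is handled
   through E cos(U + th) = psi cos th for every phase th, which packs the
   real and imaginary parts of the transform in one real identity. *)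

Require Import Defs.
From mathcomp Require Import all_boot all_order all_algebra.
From mathcomp Require Import all_classical all_reals all_analysis.
From mathcomp Require Import measurable_realfun lra ring.

Set Implicit Arguments.
Unset Strict Implicit.
Unset Printing Implicit Defensive.

Import Order.TTheory GRing.Theory Num.Theory.
Import numFieldNormedType.Exports.

Local Open Scope classical_set_scope.
Local Open Scope ring_scope.

(** * Measurability and integrability of bounded functions of one coordinate *)

Lemma measurable_cosr (R : realType) : measurable_fun setT (@cos R).
Proof. exact: continuous_measurable_fun (@continuous_cos R). Qed.

Lemma measurable_coord (R : realType) (d : nat) (i : 'I_d) :
  measurable_fun setT (fun x : 'rV[R]_d => x 0 i).
Proof.
apply: (measurability _ (RGenOpens.measurableE R)).
move=> _ [_ [a [b ->] <-]]; rewrite setTI.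
apply: sub_sigma_algebra.
apply: open_comp; last exact: interval_open.
by move=> x _; exact: coord_continuous.
Qed.

Lemma integrable_bounded (d : measure_display) (T : measurableType d)
    (R : realType) (m : probability T R) (f : T -> R) (M : R) :
  measurable_fun setT f -> (forall w, `|f w| <= M) ->
  m.-integrable setT (EFin \o f).
Proof.
move=> mf fM; apply: (@le_integrable _ _ _ m _ measurableT _ (EFin \o cst M)).
- exact/measurable_EFinP.
- by move=> x _ /=; rewrite lee_fin (le_trans (fM x))// ler_norm.
- by apply: finite_measure_integrable_cst.
Qed.

Lemma integrable_cos (d : measure_display) (T : measurableType d)
    (R : realType) (m : probability T R) (f : T -> R) :
  measurable_fun setT f -> m.-integrable setT (fun w => (cos (f w))%:E).
Proof.
move=> mf; apply: (@integrable_bounded _ _ _ _ (cos \o f) 1) => [|w].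
  by apply: measurableT_comp mf; exact: measurable_cosr.
exact: cos_max.
Qed.

(** * Equality in law and cosine transforms of sums of independent variables *)

Lemma eq_law_integral (d d' : measure_display) (T : measurableType d)
    (T' : measurableType d') (R : realType) (m : {measure set T -> \bar R})
    (m' : {measure set T' -> \bar R}) (U : T -> R) (V : T' -> R) (g : R -> R) :
  measurable_fun setT U -> measurable_fun setT V -> measurable_fun setT g ->
  m.-integrable setT (fun w => (g (U w))%:E) ->
  m'.-integrable setT (fun w => (g (V w))%:E) ->
  (forall B, measurable B -> m (U @^-1` B) = m' (V @^-1` B)) ->
  (\int[m]_w (g (U w))%:E = \int[m']_w (g (V w))%:E)%E.
Proof.
move=> mU mV mg ig ig' UV.
have mgE : measurable_fun setT (EFin \o g) by exact/measurable_EFinP.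
rewrite -(@integral_pushforward _ _ T R R U mU m setT (EFin \o g) mgE)//.
rewrite -(@integral_pushforward _ _ T' R R V mV m' setT (EFin \o g) mgE)//.
by apply: eq_measure_integral => B mB _; exact: UV.
Qed.

(** By Fubini, at a fixed first component [u] the inner integral is the hypothesis on [V] at the
    phase [U u + th]; this is where the quantification over all phases enters. *)
Lemma integral_cos_indep (d d' : measure_display) (T : measurableType d)
    (T' : measurableType d') (R : realType) (m : probability T R)
    (m' : probability T' R) (U : T -> R) (V : T' -> R) (psi th : R) :
  measurable_fun setT U -> measurable_fun setT V ->
  (forall th, \int[m']_w (cos (V w + th))%:E = (psi * cos th)%:E)%E ->
  (\int[m \x m']_w (cos (U w.1 + V w.2 + th))%:E =
   psi%:E * \int[m]_w (cos (U w + th))%:E)%E.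
Proof.
move=> mU mV Vpsi.
have mUV : measurable_fun setT (fun w : T * T' => U w.1 + V w.2 + th).
  apply: measurable_funD => //; apply: measurable_funD.
    by apply: measurableT_comp mU _; exact: measurable_fst.
  by apply: measurableT_comp mV _; exact: measurable_snd.
pose f := fun w : T * T' => (cos (U w.1 + V w.2 + th))%:E.
rewrite -[LHS](@integral12_prod_meas1 _ _ T T' R m m' f); last first.
  exact: integrable_cos.
rewrite -integralZl//; last first.
  by apply: integrable_cos; exact: measurable_funD.
apply: eq_integral => u _; rewrite /f/= -EFinM -Vpsi.
by apply: eq_integral => v _; congr (cos _)%:E; ring.
Qed.

(** Rectangles are stable under intersection and generate the product sigma-algebra, so two measures
    agreeing on them, one of finite mass, are equal. *)
Lemma rectangle_measure_unique (R : realType)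
    (m1 m2 : {measure set (R * R) -> \bar R}) :
  (m1 setT < +oo)%E ->
  (forall A B : set R, measurable A -> measurable B ->
     m1 (A `*` B) = m2 (A `*` B)) ->
  forall X, measurable X -> m1 X = m2 X.
Proof.
move=> fin1 m12 X mX.
pose C : set (set (R * R)) :=
  [set C | exists A, measurable A /\ exists B, measurable B /\ C = A `*` B].
apply: (measure_unique C (fun=> setT)) => //.
- rewrite measurable_prod_measurableType //; congr (<<s _ >>).
  rewrite predeqE; split => [[A mA [B mB <-]]|[A [mA [B [mB ->]]]]].
    by exists A; split => //; exists B.
  by exists A => //; exists B.
- move=> /= _ _ [X1 [mX1 [X2 [mX2 ->]]]] [Y1 [mY1 [Y2 [mY2 ->]]]].
  rewrite -setXI; exists (X1 `&` Y1); split; first exact: measurableI.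
  by exists (X2 `&` Y2); split => //; exact: measurableI.
- by move=> n; exists setT; split => //; exists setT; split; rewrite ?setXTT.
- by rewrite bigcup_const.
- by move=> A [A1 [mA1 [A2 [mA2 ->]]]]; rewrite m12.
Qed.

Section indep_pair.
Context (d : measure_display) (T : measurableType d) (R : realType)
  (P : probability T R) (U V : T -> R).
Hypotheses (mU : measurable_fun setT U) (mV : measurable_fun setT V).

Let measurable_preim (W : T -> R) (A : set R) : measurable_fun setT W ->
  measurable A -> measurable (W @^-1` A).
Proof. by move=> mW mA; rewrite -[X in measurable X]setTI; exact: mW. Qed.

(** Two measures on the plane are compared: the image under [(U, V)] of [P] restricted to [E], and
    that of [P] scaled by [P E]. They agree on rectangles, hence on the set of pairs whose sum lies
    in [A]. *)
Lemma event_indep_add (E : set T) : measurable E ->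
  (forall A B, measurable A -> measurable B ->
     (P (U @^-1` A `&` V @^-1` B `&` E) =
      P E * P (U @^-1` A `&` V @^-1` B))%E) ->
  forall A, measurable A ->
    (P ((fun w => (U w + V w)%R) @^-1` A `&` E) = P E * P ((fun w => (U w + V w)%R) @^-1` A))%E.
Proof.
move=> mE UVE A mA.
pose W w := (U w, V w).
have mW : measurable_fun setT W by by apply/measurable_fun_pairP; split.
have PE0 : 0 <= fine (P E) by apply: fine_ge0.
have PEfin : P E \is a fin_num by exact: fin_num_measure.
have mS : measurable [set z : R * R | A (z.1 + z.2)].
  rewrite -[X in measurable X]setTI.
  exact: (measurable_funD measurable_fst measurable_snd).
have scE X : mscale (NngNum PE0) (pushforward P W) X = (P E * P (W @^-1` X))%E.
  by rewrite /mscale /= fineK.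
rewrite -(scE mW [set z | A (z.1 + z.2)]).
apply: (@rectangle_measure_unique R (pushforward (mrestr P mE) W)
  (mscale (NngNum PE0) (pushforward P W)) _ _ _ mS).
  change (P (setT `&` E) < +oo)%E; rewrite setTI.
  exact: le_lt_trans (probability_le1 P mE) (ltry 1).
move=> B C mB mC; apply: etrans (esym (scE mW _)).
exact: UVE.
Qed.

(** Independence on rectangles identifies the joint law of [(U, V)] with the product law, so the
    integral can be moved to [P \x P], where [integral_cos_indep] computes it. *)
Lemma integral_cos_add (psi : R) :
  (forall A B, measurable A -> measurable B ->
     (P (U @^-1` A `&` V @^-1` B) = P (U @^-1` A) * P (V @^-1` B))%E) ->
  (forall th, \int[P]_w (cos (V w + th))%:E = (psi * cos th)%:E)%E ->
  forall th, (\int[P]_w (cos (U w + V w + th))%:E =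
    psi%:E * \int[P]_w (cos (U w + th))%:E)%E.
Proof.
move=> UV Vpsi th.
rewrite -(integral_cos_indep P th mU mV Vpsi).
pose W w := (U w, V w).
have mW : measurable_fun setT W by apply/measurable_fun_pairP; split.
pose W' (z : T * T) := (U z.1, V z.2).
have mU1 : measurable_fun setT (fun z : T * T => U z.1).
  by apply: measurableT_comp mU _; exact: measurable_fst.
have mV2 : measurable_fun setT (fun z : T * T => V z.2).
  by apply: measurableT_comp mV _; exact: measurable_snd.
have mW' : measurable_fun setT W' by apply/measurable_fun_pairP; split.
apply: (@eq_law_integral _ _ _ _ _ P (P \x P)%E (fun w => U w + V w)
  (fun z => U z.1 + V z.2) (fun x => cos (x + th))).
- exact: measurable_funD.
- exact: measurable_funD.
- by apply: measurableT_comp; [exact: measurable_cosr|exact: measurable_funD].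
- by apply: integrable_cos; do 2 apply: measurable_funD => //.
- by apply: integrable_cos; do 2 apply: measurable_funD => //.
move=> A mA.
have mS : measurable [set z : R * R | A (z.1 + z.2)].
  rewrite -[X in measurable X]setTI.
  exact: (measurable_funD measurable_fst measurable_snd).
apply: (@rectangle_measure_unique R
  (pushforward P W) (pushforward (P \x P)%E W') _ _ _ mS).
  by change (P setT < +oo)%E; rewrite probability_setT ltry.
move=> B C mB mC; rewrite /pushforward.
transitivity (P (U @^-1` B `&` V @^-1` C)) => //.
rewrite UV// -product_measure1E//; exact: measurable_preim.
Qed.

End indep_pair.

Section indep_sum.
Context (d : measure_display) (T : measurableType d) (R : realType)
  (P : probability T R) (n : nat) (V : nat -> T -> R).
Hypothesis mV : forall k, measurable_fun setT (V k).
Hypothesis indepV : forall A : nat -> set R, (forall k, measurable (A k)) ->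
  P [set w | forall k, (k < n)%N -> A k (V k w)] =
  (\prod_(k < n) P (V k @^-1` A k))%E.

Let S j w := \sum_(k < j) V k w.

Let measurable_S j : measurable_fun setT (S j).
Proof. by by apply: measurable_sum => k; exact: mV. Qed.

(** The future of index [j]: only the variables from [j] up to [n - 1] are constrained. Independence
    of [S j] from all such events is the invariant of the induction below. *)
Let E j (A : nat -> set R) :=
  [set w | forall k, (j <= k < n)%N -> A k (V k w)].

Let measurable_E j A : (forall k, measurable (A k)) -> measurable (E j A).
Proof.
move=> mA; have -> : E j A =
    \bigcap_(k in [set k | (j <= k < n)%N]) (V k @^-1` A k) by [].
apply: bigcap_measurableType => k _.
by rewrite -[X in measurable X]setTI; exact: mV.
Qed.

Let PE_split j A : (forall k, measurable (A k)) -> (j < n)%N ->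
  P (E j A) = (P (V j @^-1` A j) * P (E j.+1 A))%E.
Proof.
move=> mA jn.
(* Filling the slots below [i] with the full space turns the tail event into one covered by
   [indepV]. *)
have PE i : P (E i A) =
    (\prod_(k < n) P (V k @^-1` (if (i <= k)%N then A k else setT)))%E.
  rewrite -(@indepV (fun k => if (i <= k)%N then A k else setT)).
    congr (P _); apply/seteqP; split => w /= Ew k.
      by move=> kn; case: ifPn => // ik; apply: Ew; rewrite ik.
    by move=> /andP[ik kn]; have := Ew k kn; rewrite ik.
  by move=> k; case: ifP.
rewrite !PE (bigD1 (Ordinal jn))//= [in RHS](bigD1 (Ordinal jn))//=.
rewrite leqnn ltnn preimage_setT probability_setT mul1e.
congr (_ * _)%E; apply: eq_bigr => k; rewrite -val_eqE/= => kj.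
by rewrite [in RHS]ltn_neqAle eq_sym kj.
Qed.

(** Induction on [j], with [A] general. Since [S j.+1] is [S j + V j], a constraint on [V j] is
    merged with the future [E j.+1 A] into a single event [E j A'], to which the induction
    hypothesis applies; [PE_split] then separates [V j] from the later variables. *)
Let indep_S j (A : nat -> set R) (B : set R) : (j <= n)%N ->
  (forall k, measurable (A k)) -> measurable B ->
  P (S j @^-1` B `&` E j A) = (P (E j A) * P (S j @^-1` B))%E.
Proof.
elim: j A B => [|j IH] A B jn mA mB.
  have -> : S 0 = cst 0 by apply/funext => w; rewrite /S big_ord0.
  rewrite preimage_cst; case: ifPn => _.
    by rewrite setTI probability_setT mule1.
  by rewrite set0I measure0 mule0.
have SS : S j.+1 = (fun w => S j w + V j w).
  by apply/funext => w; rewrite /S big_ord_recr.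
rewrite SS; apply: event_indep_add => //; first exact: measurable_E.
move=> C D mC mD.
(* [A'] inserts the constraint on [V j] into the future; [A''] retains that constraint alone. *)
pose A' k := if k == j then D else A k.
pose A'' k := if k == j then D else setT.
have mA' k : measurable (A' k) by rewrite /A'; case: ifP.
have mA'' k : measurable (A'' k) by rewrite /A''; case: ifP.
have EA' : V j @^-1` D `&` E j.+1 A = E j A'.
  apply/seteqP; split => w /=.
    move=> [Dw Ew] k /andP[jk kn]; rewrite /A'; case: eqP => [->//|/eqP kj].
    by apply: Ew; rewrite ltn_neqAle eq_sym kj jk.
  move=> Ew; split; first by have := Ew j; rewrite /A' eqxx leqnn jn; apply.
  move=> k /andP[jk kn]; have := Ew k; rewrite /A' gtn_eqF//.
  by rewrite (ltnW jk) kn; apply.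
have EA'' : V j @^-1` D = E j A''.
  apply/seteqP; split => w /=.
    by move=> Dw k _; rewrite /A''; case: eqP => [->|].
  by move=> Ew; have := Ew j; rewrite /A'' eqxx leqnn jn; apply.
have EA1 : E j.+1 A' = E j.+1 A.
  apply/seteqP; split => w /= Ew k jkn.
    by have := Ew k jkn; rewrite /A' gtn_eqF//; case/andP: jkn.
  by rewrite /A' gtn_eqF//; [exact: Ew|case/andP: jkn].
rewrite -setIA EA' EA'' !IH// ?(ltnW jn)//.
rewrite (PE_split mA')// EA1 /A' eqxx -EA''.
by rewrite muleA (muleC (P (E _ _))).
Qed.

(** Variables are added one at a time: [indep_S], with a constraint in slot [j] only, makes [V j]
    independent of [S j], and [integral_cos_add] multiplies the transforms. *)
Lemma integral_cos_sum (psi : nat -> R) :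
  (forall k, (k < n)%N -> forall th,
     \int[P]_w (cos (V k w + th))%:E = (psi k * cos th)%:E)%E ->
  forall th, (\int[P]_w (cos (\sum_(k < n) V k w + th))%:E =
    ((\prod_(k < n) psi k) * cos th)%:E)%E.
Proof.
move=> Vpsi.
suff H j : (j <= n)%N -> forall th, (\int[P]_w (cos (S j w + th))%:E =
    ((\prod_(k < j) psi k) * cos th)%:E)%E by exact: H.
elim: j => [_ th|j IH jn th].
  rewrite big_ord0 mul1r.
  under eq_integral do rewrite /S big_ord0 add0r.
  by rewrite integral_cst// [X in (_ * X)%E](@probability_setT _ _ _ P) mule1.
under eq_integral do rewrite /S big_ord_recr/=.
rewrite (@integral_cos_add _ _ _ P (S j) (V j) _ _ (psi j))//.
- by rewrite IH ?(ltnW jn)// -EFinM big_ord_recr/=; congr EFin; ring.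
- move=> C D mC mD.
  pose A k := if k == j then D else setT.
  have mA k : measurable (A k) by rewrite /A; case: ifP.
  have EA : V j @^-1` D = E j A.
    apply/seteqP; split => w /=.
      by move=> Dw k _; rewrite /A; case: eqP => [->|].
    by move=> Ew; have := Ew j; rewrite /A eqxx leqnn jn; apply.
  by rewrite EA indep_S// ?(ltnW jn)// muleC.
- exact: Vpsi.
Qed.

End indep_sum.

(** * Pathwise convergence of the implicit Euler scheme *)

Lemma cadlag_bounded (R : realType) (f : R -> R) (t : R) :
  (forall s, 0 <= s -> f u @[u --> s^'+] --> f s) ->
  (forall s, 0 < s -> cvg (f u @[u --> s^'-])) ->
  exists2 M, 0 <= M & forall s, 0 <= s <= t -> `|f s| <= M.
Proof.
move=> fr fl.
(* Compactness in the form: if near each [s] every large enough [M] is a bound, then every large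
   enough [M] is a bound on the whole segment. Local bounds come from the one-sided limits. *)
have : near_covering `[0, t] by exact/compact_near_coveringP/segment_compact.
move=> /(_ R +oo%R (fun M s => 0 <= s -> `|f s| <= M) _).
have near_bnd l (F : set_system R) : Filter F -> f u @[u --> F] --> l ->
    \forall u \near F, `|f u| <= `|l| + 1.
  move=> FF /cvgrPdist_le/(_ 1 ltr01); apply: filterS => u lfu.
  by rewrite -lerBlDl (le_trans _ lfu)// (le_trans (lerB_dist _ _))// distrC.
case.
  move=> s; rewrite /= in_itv/= => /andP[s0 st].
  have [C1 hC1] : exists C, \forall u \near s, s < u -> `|f u| <= C.
    by exists (`|f s| + 1); have := near_bnd _ _ _ (fr s s0); apply.
  have [C2 hC2] : exists C, \forall u \near s, u < s -> 0 <= u -> `|f u| <= C.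
    have [s_gt0|s_le0] := ltP 0 s.
      exists (`|lim (f u @[u --> s^'-])| + 1).
      have h := near_bnd _ _ _ (fl s s_gt0).
      near=> u => us _; move: us; near: u; exact: h.
    (* Here [s] is not positive, so no [u] satisfies [0 <= u < s] and any constant will do. *)
    exists 0; near=> u => us u0.
    by move: (lt_le_trans us s_le0); rewrite ltNge u0.
  exists ([set u | (s < u -> `|f u| <= C1) /\
                   (u < s -> 0 <= u -> `|f u| <= C2)],
          [set M | [/\ C1 <= M, C2 <= M & `|f s| <= M]]) => /=.
    split; first exact: filterI.
    near=> M; split; near: M; exact: nbhs_pinfty_ge (num_real _).
  move=> [u M] [/= [h1 h2] [M1 M2 M3]] u0.
  have [us|us|->//] := ltgtP u s; first exact: le_trans (h2 us u0) M2.
  exact: le_trans (h1 us) M1.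
move=> M [_ hM]; exists (`|M| + 1) => [|s /andP[s0 st]]; first by rewrite addr_ge0.
apply: (hM (`|M| + 1)) => //; last by rewrite /= in_itv/= s0.
by rewrite (le_lt_trans (ler_norm M))// ltrDl.
Unshelve. all: by end_near. Qed.

Section grid.
Context (R : realType) (h : R) (h0 : 0 < h).

(** The right end of the cell []k h, (k + 1) h]] containing [s]: an implicit scheme evaluates the
    drift there. *)
Definition grid (s : R) : R := h * (Num.ceil (s / h))%:~R.

Lemma grid_ge s : s <= grid s.
Proof. by rewrite /grid mulrC -ler_pdivrMr// ceil_ge. Qed.

Lemma grid_lt s : grid s < s + h.
Proof.
have /andP[+ _] := ceil_itv (s / h); rewrite rmorphB/= => H.
by rewrite /grid mulrC -ltr_pdivlMr// mulrDl divff ?gt_eqF// -ltrBlDr.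
Qed.

Lemma grid_itv k s : k%:R * h < s <= k.+1%:R * h -> grid s = k.+1%:R * h.
Proof.
move=> /andP[ks sk]; rewrite /grid mulrC; congr (_ * _).
rewrite (@ceil_def _ _ k.+1%:Z)//.
have -> : ((k.+1%:Z - 1)%:~R : R) = k%:R by rewrite intS addrAC subrr add0r.
by rewrite ltr_pdivlMr// ks ler_pdivrMr.
Qed.

Lemma grid_le k s : s <= k%:R * h -> grid s <= k%:R * h.
Proof.
move=> sk; rewrite /grid mulrC ler_pM2r//.
by rewrite -[k%:R]/((k%:Z)%:~R) ler_int ceil_le_int ler_pdivrMr.
Qed.

Lemma grid_nondecreasing : nondecreasing_fun grid.
Proof.
move=> s u su; rewrite /grid ler_pM2l// ler_int le_ceil// ler_pM2r ?invr_gt0//.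
Qed.

End grid.

Section euler.
Context (R : realType) (f l : R -> R) (x : R).
Notation mu := (@lebesgue_measure R).
Hypothesis f_int : forall s, 0 <= s -> mu.-integrable `[0, s] (EFin \o f).
Hypothesis f_eq : forall s, 0 <= s ->
  f s = x - \int[mu]_(u in `[0, s]) f u + l s.
Hypothesis f_right : forall s, 0 <= s -> f u @[u --> s^'+] --> f s.
Hypothesis f_left : forall s, 0 < s -> cvg (f u @[u --> s^'-]).
Hypothesis l0 : l 0 = 0.

(** Closed form of the implicit scheme [y_(k+1) = y_k - h * y_(k+1) + (increment of l)], that is, of
    the recursion [eulerS]. Being explicitly linear in [x] and in the increments of [l], it suits
    the Fourier computation. *)
Definition euler (h : R) (k : nat) : R :=
  (1 + h)^-1 ^+ k * x +
  \sum_(j < k) (1 + h)^-1 ^+ (k - j) * (l (j.+1%:R * h) - l (j%:R * h)).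

Lemma eulerS h k : euler h k.+1 =
  (1 + h)^-1 * (euler h k + (l (k.+1%:R * h) - l (k%:R * h))).
Proof.
rewrite /euler big_ord_recr/= subSn// subnn expr1 exprS !mulrDr mulr_sumr.
rewrite -!addrA mulrA; congr (_ + (_ + _)); apply: eq_bigr => j _.
by rewrite subSn ?exprS ?mulrA// ltnW.
Qed.

Let g (h s : R) := `|f s - f (grid h s)|.

Let measurable_g (h : R) k : 0 < h -> measurable_fun `[0, k%:R * h] (g h).
Proof.
move=> h0.
have kh0 : 0 <= k%:R * h by rewrite mulr_ge0// ltW.
have mf : measurable_fun `[0, k%:R * h] f.
  by apply/measurable_EFinP; have /integrableP[] := f_int kh0.
apply: measurableT_comp => //; apply: measurable_funB => //.
apply: (@measurable_comp _ _ _ _ _ _ `[0, k%:R * h]) => //.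
  move=> _ [s + <-]; rewrite /= !in_itv/= => /andP[s0 sk].
  by rewrite grid_le// (le_trans s0)// grid_ge.
by apply: nondecreasing_measurable => //; exact: grid_nondecreasing.
Qed.

Let g_bounded k (h : R) : 0 < h ->
  exists2 M, 0 <= M & forall s, 0 <= s <= k%:R * h -> g h s <= M.
Proof.
move=> h0; have [M M0 fM] := @cadlag_bounded R f (k%:R * h) f_right f_left.
exists (M + M) => [|s /andP[s0 sk]]; first by rewrite addr_ge0.
rewrite (le_trans (ler_normB _ _))// lerD// fM// ?s0//.
by rewrite grid_le// (le_trans s0)// grid_ge.
Qed.

Let integrable_g (h : R) k : 0 < h -> mu.-integrable `[0, k%:R * h] (EFin \o g h).
Proof.
move=> h0; apply: measurable_bounded_integrable => //.
- by rewrite /= lebesgue_measure_itv/=; case: ifP => _; rewrite ?ltry// -EFinB ltry.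
- exact: measurable_g.
have [M M0 gM] := g_bounded k h0.
exists M; split; first exact: num_real.
move=> y My s; rewrite /= in_itv/= => sk.
by rewrite normr_id (le_trans (gM s sk))// ltW.
Qed.

(** On one cell the new error is [(1 + h)^-1] times the old error minus [D], the integral over the
    cell of the drift discrepancy. The factor is at most 1, so the errors of the cells merely add
    up. *)
Lemma euler_error (h : R) k : 0 < h ->
  `|f (k%:R * h) - euler h k| <= \int[mu]_(s in `[0, k%:R * h]) g h s.
Proof.
move=> h0; elim: k => [|k IH].
  rewrite mul0r f_eq// set_itv1 Rintegral_set1 l0 /euler big_ord0 expr0.
  by rewrite mul1r !(subr0, addr0) subrr normr0 Rintegral_set1.
set a := k%:R * h in IH *; set b := k.+1%:R * h.
have ab : a < b by rewrite ltr_pM2r// ltr_nat.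
have a0 : 0 <= a by rewrite mulr_ge0// ltW.
have b0 : 0 <= b := le_trans a0 (ltW ab).
have ba : b - a = h by rewrite -mulrBl -natrB// subSnn mul1r.
have sub_ab : `]a, b] `<=` `[0, b].
  by move=> s; rewrite /= !in_itv/= => /andP[/ltW/(le_trans a0)-> ->].
have h10 : 0 < 1 + h by rewrite addr_gt0.
pose D := \int[mu]_(s in `]a, b]) (f s - f b).
have fab : mu.-integrable `]a, b] (EFin \o f).
  by apply: integrableS (f_int b0).
have cab : mu.-integrable `]a, b] (EFin \o cst (f b)).
  apply: measurable_bounded_integrable => //; last exact: bounded_cst.
  by rewrite /= lebesgue_measure_itv/= lte_fin ab -EFinB ltry.
have DE : D = f a - f b + (l b - l a) - h * f b.
  rewrite /D RintegralB// Rintegral_cst//= lebesgue_measure_itv/= lte_fin ab/=.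
  rewrite ba (mulrC _ h); congr (_ - _).
  rewrite -(@Rintegral_itvB _ f (BLeft 0) (BRight b) a) ?bnd_simp//; last 2 first.
  - exact: f_int.
  - exact: ltW.
  by rewrite (f_eq a0) (f_eq b0); ring.
have fE : f b - euler h k.+1 = (1 + h)^-1 * (f a - euler h k - D).
  rewrite eulerS DE -/a -/b; field.
  by rewrite gt_eqF.
have gab : mu.-integrable `]a, b] (EFin \o g h).
  by apply: integrableS (integrable_g k.+1 h0).
have -> : \int[mu]_(s in `[0, b]) g h s =
   \int[mu]_(s in `[0, a]) g h s + \int[mu]_(s in `]a, b]) g h s.
  rewrite -(@Rintegral_itvB _ (g h) (BLeft 0) (BRight b) a) ?bnd_simp//.
  - by rewrite addrC subrK.
  - exact: (integrable_g k.+1 h0).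
  - exact: ltW.
have ih0 : 0 <= (1 + h)^-1 by rewrite invr_ge0 ltW.
rewrite fE normrM (ger0_norm ih0).
apply: (@le_trans _ _ `|f a - euler h k - D|).
  by rewrite ler_piMl// invf_le1// lerDl ltW.
rewrite (le_trans (ler_normB _ _))// lerD//.
rewrite /D (le_trans (le_normr_Rintegral _ _))//.
  have -> : EFin \o (fun s => f s - f b) =
    ((EFin \o f) \- (EFin \o cst (f b)))%E by [].
  exact: integrableB.
(* On the cell [grid h s] is [b], so the integrands coincide. The cell is open at [a] because
   [grid h a] is [a]. *)
rewrite le_eqVlt; apply/orP; left; apply/eqP; apply: eq_Rintegral => s.
by rewrite inE/= in_itv/= => sab; rewrite /g (grid_itv h0 sab).
Qed.

(** The bound of [euler_error] tends to 0 by dominated convergence: [grid h s] approaches [s] from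
    the right, where [f] is right-continuous, and [f] is bounded on [[0, t]]. *)
Lemma cvg_euler (t : R) : 0 < t ->
  euler (t / n.+1%:R) n.+1 @[n --> \oo] --> f t.
Proof.
move=> t0; pose h n : R := t / n.+1%:R.
have h0 n : 0 < h n by rewrite divr_gt0.
have nh n : n.+1%:R * h n = t by rewrite /h mulrC divfK.
have h_cvg : h n @[n --> \oo] --> (0 : R).
  rewrite -(mulr0 t); apply: cvgM; first exact: cvg_cst.
  exact: cvg_harmonic.
have mg n : measurable_fun `[0, t] (g (h n)).
  by have := @measurable_g _ n.+1 (h0 n); rewrite nh.
have [M M0 fM] := @cadlag_bounded R f t f_right f_left.
have gs0 : {ae mu, forall s, `[0, t]%classic s ->
    (g (h n) s)%:E @[n --> \oo] --> (0 : \bar R)%E}.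
  apply: aeW => s; rewrite /= in_itv/= => /andP[s0 st].
  apply: cvg_EFin; first by near=> n.
  apply/cvgr0Pnorm_lt => e e0.
  have /cvgrPdist_lt/(_ e e0)[d /= d0 H] := f_right s0.
  have /cvgr0Pnorm_lt/(_ d d0) := h_cvg.
  apply: filterS => n; rewrite gtr0_norm// => hd; rewrite /= normr_id.
  have := grid_ge (h0 n) s; rewrite le_eqVlt => /predU1P[<-|sg].
    by rewrite subrr normr0.
  apply: H => //=; rewrite distrC gtr0_norm ?subr_gt0//.
  by rewrite ltrBlDl (lt_trans (grid_lt (h0 n) s))// ltrD2l.
have cst_int : mu.-integrable `[0, t] (cst (M + M)%:E).
  apply: (@measurable_bounded_integrable _ _ _ mu (cst (M + M))) => //.
    by rewrite /= lebesgue_measure_itv/= lte_fin t0 -EFinB ltry.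
  exact: bounded_cst.
have g_le : {ae mu, forall s n, `[0, t]%classic s ->
    (`|(g (h n) s)%:E| <= cst (M + M)%:E s)%E}.
  apply: aeW => s n; rewrite /= in_itv/= => /andP[s0 st].
  rewrite lee_fin normr_id (le_trans (ler_normB _ _))// lerD// fM// ?s0//.
  rewrite (le_trans s0) ?grid_ge//=.
  (* The end point [t] is itself the grid point of index [n.+1], so [grid] does not leave the
     segment. *)
  by have := @grid_le _ _ (h0 n) n.+1 s; rewrite nh; apply.
have g_cvg : \int[mu]_(s in `[0, t]) g (h n) s @[n --> \oo] --> (0 : R).
  have [_ _] := @dominated_convergence _ _ R mu `[0, t] (measurable_itv _)
    (fun n s => (g (h n) s)%:E) (cst 0%E) (cst (M + M)%:E)
    (fun n => (measurable_EFinP _ _).2 (mg n)) (measurable_cst _) gs0 cst_int g_le.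
  rewrite integral0 => /fine_cvg.
  by apply: cvg_trans; apply: near_eq_cvg; near=> n.
apply/cvgrPdist_le => e e0.
move/cvgr0Pnorm_le : g_cvg => /(_ e e0); apply: filterS => n.
apply: le_trans; rewrite -[X in f X](nh n) (le_trans (euler_error _ _))// nh.
exact: ler_norm.
Unshelve. all: end_near. Qed.

End euler.

(** * Limits of the Euler weights and of the resulting exponent *)

Lemma cvg_difference_quotient (R : realType) (f : R -> R) (x df : R)
    (u : nat -> R) : is_derive x 1 f df -> (forall n, u n != 0) ->
  u n @[n --> \oo] --> 0 ->
  (f (x + u n) - f x) / u n @[n --> \oo] --> df.
Proof.
move=> [dfx <-] u0 u_cvg.
have /cvgr_dnbhsP/(_ u (conj u0 u_cvg)) : h^-1 *: (f (h *: 1 + x) - f x)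
    @[h --> 0^'] --> 'D_1 f x by exact: dfx.
apply: cvg_trans; apply: near_eq_cvg; near=> n.
by rewrite /= [(u n)%:A]mulr1 (addrC (u n)) [RHS]mulrC.
Unshelve. all: by end_near. Qed.

Lemma sum_geometric (R : realFieldType) (q : R) (n : nat) :
  (1 - q) * \sum_(k < n) q ^+ (n - k) = q * (1 - q ^+ n).
Proof.
elim: n => [|n IH]; first by rewrite big_ord0 expr0 subrr !mulr0.
rewrite big_ord_recr/= subSnn expr1 exprS.
have -> : \sum_(i < n) q ^+ (n.+1 - i) = q * \sum_(i < n) q ^+ (n - i).
  by rewrite mulr_sumr; apply: eq_bigr => i _; rewrite subSn ?exprS// ltnW.
by rewrite mulrDr mulrCA IH; ring.
Qed.

Section euler_limits.
Context (R : realType) (t a : R) (t0 : 0 < t) (a0 : 0 < a).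

Let h n : R := t / n.+1%:R.
Let h0 n : 0 < h n. Proof. by rewrite divr_gt0. Qed.
Let hD0 n : 0 < 1 + h n. Proof. by rewrite addr_gt0. Qed.
Let h_cvg : h n @[n --> \oo] --> (0 : R).
Proof.
by rewrite -(mulr0 t); apply: cvgM; [exact: cvg_cst|exact: cvg_harmonic].
Qed.

(** Written as an exponential, the weight has exponent [- t] times the difference quotient of [ln]
    at 1, whose limit is 1. *)
Lemma cvg_euler_weight :
  (1 + t / n.+1%:R)^-1 ^+ n.+1 @[n --> \oo] --> expR (- t).
Proof.
have E n : (1 + h n)^-1 ^+ n.+1 =
    expR (- (t * ((ln (1 + h n) - ln 1) / h n))).
  rewrite ln1 subr0 -[(1 + h n)^-1]lnK ?posrE ?invr_gt0// lnV ?posrE//.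
  rewrite -expRM_natr; congr expR; rewrite /h; field.
  by apply/andP; split; [rewrite nat1r|]; rewrite gt_eqF.
under eq_fun do rewrite -/(h _) E.
apply: continuous_cvg; first exact: continuous_expR.
apply: cvgN; rewrite -[X in _ --> X]mulr1; apply: cvgM; first exact: cvg_cst.
apply: cvg_difference_quotient h_cvg => [|n]; last by rewrite gt_eqF.
by apply: is_derive_eq; [exact: is_derive1_ln|rewrite invr1].
Qed.

(** This is a Riemann sum for the integral of [expR (- a * s)] over [[0, t]]. Summing the geometric
    series leaves in the denominator the difference quotient of the power [a] at 1, which tends to
    [a]. *)
Lemma cvg_euler_exponent :
  \sum_(k < n.+1) t / n.+1%:R *
    ((1 + t / n.+1%:R)^-1 ^+ (n.+1 - k)) `^ a @[n --> \oo] -->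
  (1 - expR (- t) `^ a) / a.
Proof.
pose q n := (1 + h n)^-1 `^ a.
have qX n k : ((1 + h n)^-1 ^+ k) `^ a = q n ^+ k.
  by rewrite -!powR_mulrn ?powR_ge0 ?invr_ge0 ?ltW// powRAC.
have E n : \sum_(k < n.+1) h n * ((1 + h n)^-1 ^+ (n.+1 - k)) `^ a =
   (1 - ((1 + h n)^-1 ^+ n.+1) `^ a) /
   (((1 + h n) `^ a - 1 `^ a) / h n).
  under eq_bigr do rewrite qX.
  rewrite -mulr_sumr qX powR1.
  have qV : (1 + h n) `^ a = (q n)^-1.
    by rewrite -powRN -powR_inv1 ?ltW// -powRrM mulrN mulN1r opprK.
  have q0 : 0 < q n by rewrite powR_gt0// invr_gt0.
  have q1 : q n < 1.
    have : 1 `^ a < (1 + h n) `^ a.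
      by rewrite gt0_ltr_powR ?nnegrE ?ltrDl// ltW.
    by rewrite powR1 qV invf_gt1.
  rewrite qV.
  have qN1 : 1 - q n != 0 by rewrite gt_eqF// subr_gt0.
  rewrite (canRL (mulKf qN1) (sum_geometric (q n) n.+1)); field.
  by rewrite mulN1r qN1 !gt_eqF.
under eq_fun do rewrite -/(h _) E.
apply: cvgM.
  apply: cvgB; first exact: cvg_cst.
  have cpow : {for expR (- t), continuous (fun x : R => x `^ a)}.
    apply: differentiable_continuous; apply/derivable1_diffP.
    by apply: derivable_powR; rewrite in_itv/= andbT expR_gt0.
  exact: (continuous_cvg _ cpow cvg_euler_weight).
apply: cvgV; first by rewrite gt_eqF.
apply: (@cvg_difference_quotient R (fun x => x `^ a) 1 a h _ _ h_cvg) => [|n].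
  by apply: is_derive_eq; [exact: is_derive1_powR|rewrite powR1 mulr1].
by rewrite gt_eqF.
Qed.

End euler_limits.

(** * Almost sure equality and almost sure limits *)

Lemma ae_eq_preimage (d : measure_display) (T : measurableType d)
    (R : realType) (P : {measure set T -> \bar R}) (U V : T -> R) (B : set R) :
  measurable_fun setT U -> measurable_fun setT V -> measurable B ->
  {ae P, forall w, U w = V w} -> P (U @^-1` B) = P (V @^-1` B).
Proof.
move=> mU mV mB UV.
have mp (W : T -> R) : measurable_fun setT W -> measurable (W @^-1` B).
  by move=> mW; rewrite -[X in measurable X]setTI; exact: mW.
have PE (W : T -> R) : measurable_fun setT W ->
    (P (W @^-1` B) = \int[P]_w (\1_(W @^-1` B) w)%:E)%E.
  by move=> mW; rewrite integral_indic ?setIT//; exact: mp.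
rewrite !PE//; apply: ae_eq_integral => //.
- by apply/measurable_EFinP/measurable_indic; exact: mp.
- by apply/measurable_EFinP/measurable_indic; exact: mp.
apply: filterS UV => w UVw _; rewrite !indicE.
by have -> : (w \in U @^-1` B) = (w \in V @^-1` B)
  by apply/idP/idP; rewrite !inE/= UVw.
Qed.

Lemma integral_cos_cvg (d : measure_display) (T : measurableType d)
    (R : realType) (P : probability T R) (U : nat -> T -> R) (V : T -> R)
    (th : R) :
  (forall n, measurable_fun setT (U n)) -> measurable_fun setT V ->
  {ae P, forall w, U n w @[n --> \oo] --> V w} ->
  (\int[P]_w (cos (U n w + th))%:E @[n --> \oo] -->
   \int[P]_w (cos (V w + th))%:E)%E.
Proof.
move=> mU mV UV.
have mc (W : T -> R) : measurable_fun setT W ->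
    measurable_fun setT (fun w => (cos (W w + th))%:E).
  move=> mW; apply/measurable_EFinP; apply: measurableT_comp.
    exact: measurable_cosr.
  exact: measurable_funD.
have [] // := @dominated_convergence _ _ R P setT measurableT
  (fun n w => (cos (U n w + th))%:E) (fun w => (cos (V w + th))%:E) (cst 1%E)
  (fun n => mc _ (mU n)) (mc _ mV) _ _ _.
- apply: filterS UV => w UVw _; apply: cvg_EFin; first by near=> n.
  apply: continuous_cvg; first exact: continuous_cos.
  by apply: cvgD => //; exact: cvg_cst.
- exact: finite_measure_integrable_cst.
- by apply: aeW => w n _ /=; rewrite lee_fin cos_max.
Unshelve. all: by end_near. Qed.

(** * Ornstein-Uhlenbeck processes with noise of index [a], treating the stable and Brownian cases
    together *)

Section ou_process.
Context (dO : measure_display) (Om : measurableType dO) (R : realType)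
  (P : probability Om R) (d : nat) (i : 'I_d) (L : R -> Om -> 'rV[R]_d)
  (X : 'rV[R]_d -> R -> Om -> 'rV[R]_d) (a : R).
Hypothesis a0 : 0 < a.
Hypothesis mL : forall t, 0 <= t -> measurable_fun setT (L t).
Hypothesis L_start : {ae P, forall w, L 0 w = 0}.
Hypothesis L_indep : independent_increments P L.
Hypothesis L_char : forall s t c, 0 <= s -> s < t -> 0 < c -> forall th,
  (\int[P]_w (cos (c * (L t w - L s w) 0 i + th))%:E =
   (expR (- ((t - s) * c `^ a / 2)) * cos th)%:E)%E.
Hypothesis X_sol : forall x, ou_solution P L x (X x).

Let l (w : Om) (s : R) : R := L s w 0 i.
Let e (x : 'rV[R]_d) (t : R) n w := euler (l w) (x 0 i) (t / n.+1%:R) n.+1.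

Let measurable_l (t : R) : 0 <= t -> measurable_fun setT (l ^~ t).
Proof. by move=> t0; exact: (measurableT_comp (measurable_coord i) (mL t0)). Qed.

Let measurable_X x (t : R) : 0 <= t -> measurable_fun setT (fun w => X x t w 0 i).
Proof.
move=> t0; have [mX _ _] := X_sol x.
exact: (measurableT_comp (measurable_coord i) (mX t t0)).
Qed.

Let euler_cvg x (t : R) : 0 < t ->
  {ae P, forall w, e x t n w @[n --> \oo] --> X x t w 0 i}.
Proof.
move=> t0; have [_ X_cadlag X_eq] := X_sol x.
apply: filterS3 L_start X_cadlag X_eq => w Lw [Xr Xl] Xw.
apply: (@cvg_euler R (fun s => X x s w 0 i) (l w) (x 0 i)) => //.
- by move=> s s0; have [] := Xw s s0 i.
- by move=> s s0; have [] := Xw s s0 i.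
- move=> s s0; apply: (@cvg_comp _ _ _ (fun u => X x u w)
    (fun v : 'rV[R]_d => v 0 i) _ _ _ (Xr s s0)).
  exact: coord_continuous.
- move=> s s0; have /cvg_ex[v Xv] := Xl s s0.
  apply/cvg_ex; exists (v 0 i).
  apply: (@cvg_comp _ _ _ (fun u => X x u w)
    (fun v : 'rV[R]_d => v 0 i) _ _ _ Xv).
  exact: coord_continuous.
- by rewrite /l Lw mxE.
Qed.

(** The schemes started at [x] and at 0 share the same noise terms and differ only by the weight
    times [x 0 i]; the limit of the weight is [expR (- t)]. *)
Lemma ou_affine x (t : R) : 0 < t ->
  {ae P, forall w, X x t w 0 i = expR (- t) * x 0 i + X 0 t w 0 i}.
Proof.
move=> t0; apply: filterS2 (euler_cvg x t0) (euler_cvg 0 t0) => w ex e0.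
apply: (cvg_unique _ ex) => //.
rewrite (_ : (fun n => e x t n w) = (fun n =>
    (1 + t / n.+1%:R)^-1 ^+ n.+1 * x 0 i + e 0 t n w)); last first.
  by apply/funext => n; rewrite /e /euler mxE mulr0 add0r.
by apply: cvgD => //; apply: cvgM; [exact: cvg_euler_weight|exact: cvg_cst].
Qed.

(** Started at 0, the scheme is a sum of independent rescaled increments, so the transforms given by
    [L_char] multiply and their exponents add. *)
Let integral_cos_euler (t : R) n (th : R) : 0 < t ->
  (\int[P]_w (cos (e 0 t n w + th))%:E =
   (expR (- ((\sum_(k < n.+1) t / n.+1%:R *
     ((1 + t / n.+1%:R)^-1 ^+ (n.+1 - k)) `^ a) / 2)) * cos th)%:E)%E.
Proof.
move=> t0; set h := t / n.+1%:R; set c := (1 + h)^-1.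
have h0 : 0 < h by rewrite divr_gt0.
have c0 : 0 < c by rewrite invr_gt0 addr_gt0.
have kh0 k : 0 <= k%:R * h by rewrite mulr_ge0// ltW.
pose V k w := c ^+ (n.+1 - k) * (L (k.+1%:R * h) w - L (k%:R * h) w) 0 i.
have VE k w : V k w =
    c ^+ (n.+1 - k) * (l w (k.+1%:R * h) - l w (k%:R * h)).
  by rewrite /V !mxE.
under eq_integral.
  move=> w _; rewrite /e /euler mxE mulr0 add0r -/h -/c.
  under eq_bigr do rewrite -VE.
  over.
rewrite (@integral_cos_sum _ _ _ P n.+1 V _ _
  (fun k => expR (- (h * (c ^+ (n.+1 - k)) `^ a / 2)))).
- by rewrite -expR_sum sumrN mulr_suml.
- move=> k.
  rewrite (_ : V k = fun w => c ^+ (n.+1 - k) *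
    (l w (k.+1%:R * h) - l w (k%:R * h))); last exact/funext/VE.
  by apply: measurable_funM => //; apply: measurable_funB; exact: measurable_l.
- move=> A mA.
  (* The scaling by [c ^+ (n.+1 - k)] and the choice of coordinate are absorbed into the sets tested
     on the increments. *)
  have := @L_indep n.+1 (fun k => k%:R * h) (kh0 0%N) _
    (fun k => [set v : 'rV_d | A k (c ^+ (n.+1 - k) * v 0 i)]) _.
  rewrite /V => <-.
  + congr (P _); apply/seteqP; split => w /= Aw k; first exact: Aw.
    by move=> kn; exact: (Aw (Ordinal kn)).
  + by move=> k; rewrite ler_pM2r// ler_nat.
  + move=> k; rewrite -[X in measurable X]setTI.
    have : measurable_fun setT (fun v : 'rV[R]_d => c ^+ (n.+1 - k) * v 0 i).
      by apply: measurable_funM => //; exact: measurable_coord.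
    by apply.
move=> k kn th'; rewrite /V L_char ?exprn_gt0//; last by rewrite ltr_pM2r// ltr_nat.
by rewrite -mulrBl -natrB// subSnn mul1r.
Qed.

Lemma ou_integral_cos (t th : R) : 0 < t ->
  (\int[P]_w (cos (X 0 t w 0 i + th))%:E =
   (expR (- ((1 - expR (- t) `^ a) / a / 2)) * cos th)%:E)%E.
Proof.
move=> t0.
have mE n : measurable_fun setT (e 0 t n).
  rewrite /e /euler; apply: measurable_funD => //; apply: measurable_sum => k.
  have h0 j : 0 <= j%:R * (t / n.+1%:R) by rewrite mulr_ge0// ltW// divr_gt0.
  by apply: measurable_funM => //; apply: measurable_funB; exact: measurable_l.
have := @integral_cos_cvg _ _ R P (e 0 t) (fun w => X 0 t w 0 i) th mE
  (measurable_X 0 (ltW t0)) (euler_cvg 0 t0).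
under eq_fun do rewrite integral_cos_euler//.
move=> /cvg_unique; apply => //.
apply: cvg_EFin; first by near=> n.
apply: cvgM; last exact: cvg_cst.
apply: continuous_cvg; first exact: continuous_expR.
apply: cvgN; apply: cvgM; last exact: cvg_cst.
exact: cvg_euler_exponent.
Unshelve. all: by end_near. Qed.

Variable mu : probability 'rV[R]_d R.
Hypothesis mu_inv : invariant_measure P X mu.

(* Under the invariant law, [x 0 i] is distributed as
   [expR (- t) * x 0 i + Z] with [Z] an independent copy of [X 0 t 0 i]. *)
Lemma ou_invariant_step (t : R) : 0 < t ->
  (\int[mu]_x (cos (x 0 i))%:E =
   (expR (- ((1 - expR (- t) `^ a) / a / 2)))%:E *
   \int[mu]_x (cos (expR (- t) * x 0 i))%:E)%E.
Proof.
move=> t0.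
pose U (x : 'rV[R]_d) := expR (- t) * x 0 i.
pose Z w := X 0 t w 0 i.
have mU : measurable_fun setT U.
  by apply: measurable_funM => //; exact: measurable_coord.
have mZ : measurable_fun setT Z by exact: measurable_X (ltW t0).
have mUZ : measurable_fun setT (fun z : 'rV[R]_d * Om => U z.1 + Z z.2).
  apply: measurable_funD.
    by apply: measurableT_comp mU _; exact: measurable_fst.
  by apply: measurableT_comp mZ _; exact: measurable_snd.
have := integral_cos_indep mu 0 mU mZ (fun th => ou_integral_cos th t0).
under eq_integral do rewrite addr0.
under [in RHS]eq_integral do rewrite addr0.
move=> <-.
apply: (@eq_law_integral _ _ _ _ R mu (mu \x P)%E _ _ (@cos R)) => //.
- exact: measurable_coord.
- exact: measurable_cosr.
- by apply: integrable_cos; exact: measurable_coord.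
- exact: integrable_cos.
move=> B mB.
have mB' : measurable [set x : 'rV[R]_d | B (x 0 i)].
  by rewrite -[X in measurable X]setTI; exact: (measurable_coord i).
(* Invariance writes the [mu]-mass as the average over starting points of transition probabilities,
   and [mu \x P] integrates the [P]-mass of sections in the same way; [ou_affine] matches the
   integrands. *)
rewrite -[LHS]/(mu [set x : 'rV[R]_d | B (x 0 i)]) -(mu_inv (ltW t0) mB').
apply: eq_integral => x _ /=.
have mUx : measurable_fun setT (fun w => U x + Z w) by exact: measurable_funD.
transitivity (P ((fun w => U x + Z w)%R @^-1` B)).
  apply: (@ae_eq_preimage _ _ R P (fun w => X x t w 0 i)) => //.
  - exact: measurable_X (ltW t0).
  - exact: ou_affine.
by congr (P _); apply/seteqP; split => w; rewrite /xsection/= inE.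
Qed.

(** In [ou_invariant_step] at [t = n + 1] the left side does not depend on [n], while on the right
    the cosine integral tends to 1 and the factor to the claimed value. *)
Lemma ou_invariant_cos :
  (\int[mu]_x (cos (x 0 i))%:E = (expR (- (1 / a / 2)))%:E)%E.
Proof.
have decay b : 0 < b -> expR (- n.+1%:R * b) @[n --> \oo] --> (0 : R).
  move=> b0; have -> : (fun n => expR (- n.+1%:R * b)) =
      [sequence expR (- b) ^+ n.+1]_n.
    by apply/funext => n /=; rewrite -expRM_natr mulrC mulrN mulNr.
  rewrite (cvg_shiftS (fun n => expR (- b) ^+ n)).
  by apply: cvg_expr; rewrite ger0_norm ?expR_ge0// expR_lt1 oppr_lt0.
have mU n : measurable_fun setT
    (fun x : 'rV[R]_d => expR (- n.+1%:R) * x 0 i).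
  by apply: measurable_funM => //; exact: measurable_coord.
have lim1 := @integral_cos_cvg _ _ R mu
  (fun n (x : 'rV[R]_d) => expR (- n.+1%:R) * x 0 i) (cst 0) 0 mU
  (measurable_cst _) _.
have {lim1} : (\int[mu]_x (cos (expR (- n.+1%:R) * x 0 i + 0))%:E @[n --> \oo]
    --> 1)%E.
  have -> : 1%E = (\int[mu]_x (cos (cst 0 x + 0 : R))%:E)%E.
    rewrite /= addr0 cos0 integral_cst// mul1e.
    exact/esym/(@probability_setT _ _ _ mu).
  apply: lim1; apply: aeW => x.
  rewrite -(mul0r (x 0 i)); apply: cvgM; last exact: cvg_cst.
  by have := decay 1 ltr01; under eq_fun do rewrite mulr1.
under eq_fun do under eq_integral do rewrite addr0.
move=> lim1.
have : (\int[mu]_x (cos (x 0 i))%:E @[n --> \oo] -->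
    (expR (- ((1 - 0) / a / 2)))%:E)%E.
  under eq_fun => n do rewrite (@ou_invariant_step n.+1%:R)//.
  rewrite -[(expR (- ((1 - 0) / a / 2)))%:E]mule1; apply: cvgeM => //.
  apply: cvg_EFin; first by near=> n.
  apply: continuous_cvg; first exact: continuous_expR.
  apply: cvgN; apply: cvgM; last exact: cvg_cst.
  apply: cvgM; last exact: cvg_cst.
  apply: cvgB; first exact: cvg_cst.
  by have := decay a a0; under eq_fun do rewrite expRM.
by rewrite subr0 => /cvg_unique H; symmetry; apply: H => //; exact: cvg_cst.
Unshelve. all: by end_near. Qed.

End ou_process.

(** * Fourier transform of the centred normal law *)

Section normal_char.
Context (R : realType) (s : R) (s0 : 0 < s).
Notation mu := (@lebesgue_measure R).
Let phi : R -> R := normal_pdf 0 s.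

Let phiE x : phi x = normal_peak s * expR (- x ^+ 2 / (s ^+ 2 *+ 2)).
Proof. by rewrite /phi normal_pdfE ?gt_eqF// /normal_fun subr0. Qed.

Let phi_ge0 x : 0 <= phi x. Proof. exact: normal_pdf_ge0. Qed.

Let mphi : measurable_fun setT phi. Proof. exact: measurable_normal_pdf. Qed.

Let dphi (x : R) : is_derive x 1 phi (- (x / s ^+ 2) * phi x).
Proof.
have -> : phi = (fun y => normal_peak s *
    (expR \o (- (s ^+ 2 *+ 2)^-1 *: (id ^+ 2 : R -> R))) y).
  apply/funext => y; rewrite phiE /=; congr (_ * expR _).
  by rewrite -[RHS]/(- (s ^+ 2 *+ 2)^-1 * (y * y)) mulNr [RHS]mulNr mulrC.
apply: is_derive_eq.
rewrite /GRing.scale/= fctE /= expr1; field.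
by rewrite gt_eqF.
Qed.

(* |x| / (2 s) <= exp(x^2 / (4 s^2)), so a multiple [G] of the density with
   variance 2 s^2 dominates |x| phi(x). *)
Let r := Num.sqrt 2 * s.
Let G x := 2 * s * normal_peak s / normal_peak r * normal_pdf 0 r x.

Let r0 : 0 < r. Proof. by rewrite mulr_gt0// sqrtr_gt0. Qed.

Let G_ge0 x : 0 <= G x.
Proof.
by rewrite mulr_ge0 ?normal_pdf_ge0// divr_ge0 ?normal_peak_ge0// !mulr_ge0
  ?normal_peak_ge0// ltW.
Qed.

Let intG : mu.-integrable setT (EFin \o G).
Proof.
rewrite (_ : EFin \o G = (fun x =>
  (2 * s * normal_peak s / normal_peak r)%:E * (normal_pdf 0 r x)%:E)%E).
  by apply: integrableZl => //; exact: integrable_normal_pdf.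
by apply/funext => x /=; rewrite EFinM.
Qed.

Let phi_G x : `|x| * phi x <= G x.
Proof.
have p0 : normal_peak r != 0 by rewrite gt_eqF// normal_peak_gt0// gt_eqF.
rewrite phiE /G normal_pdfE ?gt_eqF// /normal_fun subr0.
set E := expR (- _ ^+ 2 / (s ^+ 2 *+ 2)).
(* The variance of [r] is twice that of [s], so [E] is the square of [Er]: one factor absorbs [|x|],
   the other stays in [G]. *)
have {1}-> : E = expR (- x ^+ 2 / (r ^+ 2 *+ 2)) ^+ 2.
  rewrite /E -expRM_natl; congr expR; rewrite /r exprMn sqr_sqrtr//; field.
  by rewrite gt_eqF.
set Er := expR (- x ^+ 2 / (r ^+ 2 *+ 2)).
have Er0 : 0 < Er by exact: expR_gt0.
have -> : 2 * s * normal_peak s / normal_peak r * (normal_peak r * Er) =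
   2 * s * (normal_peak s * Er) by field.
have -> : `|x| * (normal_peak s * Er ^+ 2) = `|x| * Er * (normal_peak s * Er).
  by ring.
apply: ler_wpM2r; first by rewrite mulr_ge0 ?normal_peak_ge0// ltW.
rewrite -ler_pdivlMr// -expRN.
rewrite -ler_pdivrMl ?mulr_gt0//.
set u := (2 * s)^-1 * `|x|.
have -> : - (- x ^+ 2 / (r ^+ 2 *+ 2)) = u ^+ 2.
  rewrite /u /r !exprMn sqr_sqrtr// real_normK ?num_real//; field.
  by rewrite gt_eqF.
(* It remains that [u <= 1 + u ^+ 2]. *)
apply: le_trans (expR_ge1Dx _).
by nra.
Qed.

Let mtrig (g : R -> R) (c th : R) : continuous g ->
  measurable_fun setT (fun x => g (c * x + th)).
Proof.
move=> cg; apply: continuous_measurable_fun => x; apply: continuous_comp.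
  by apply: cvgD; [apply: cvgM; [exact: cvg_cst|exact: cvg_id]|exact: cvg_cst].
exact: cg.
Qed.

Let int_phi (g : R -> R) (c th : R) : continuous g -> (forall x, `|g x| <= 1) ->
  mu.-integrable setT (EFin \o (fun x => g (c * x + th) * phi x)).
Proof.
move=> cg g1; apply: (le_integrable _ _ _ (integrable_normal_pdf 0 s)) => //.
  by apply/measurable_EFinP; apply: measurable_funM => //; exact: mtrig.
move=> x _ /=; rewrite lee_fin normrM ler_piMl// ger0_norm//.
Qed.

Let int_xphi (g : R -> R) (c th : R) : continuous g -> (forall x, `|g x| <= 1) ->
  mu.-integrable setT (EFin \o (fun x => x * g (c * x + th) * phi x)).
Proof.
move=> cg g1; apply: (le_integrable _ _ _ intG) => //.
  apply/measurable_EFinP; apply: measurable_funM => //.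
  by apply: measurable_funM => //; exact: mtrig.
move=> x _ /=; rewrite lee_fin (ger0_norm (G_ge0 x)).
rewrite (le_trans _ (phi_G x))// !normrM (ger0_norm (phi_ge0 x)).
by rewrite ler_wpM2r// ler_piMr.
Qed.

Let J (c th x : R) := sin (c * x + th) * phi x.
Let j (c th x : R) := c * (cos (c * x + th) * phi x)
  - (s ^+ 2)^-1 * (x * sin (c * x + th) * phi x).

Let is_derive_arg (c th x : R) : is_derive x 1 (fun y : R => c * y + th) c.
Proof.
have -> : (fun y : R => c * y + th) = (c *: (id : R -> R)) + cst th by [].
by apply: is_derive_eq; rewrite addr0 [c *: 1]mulr1.
Qed.

Let dJ (c th x : R) : is_derive x 1 (J c th) (j c th x).
Proof.
have dsin : is_derive x 1 (fun y => sin (c * y + th)) (cos (c * x + th) * c).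
  exact: (@is_derive1_comp _ (@sin R) (fun y => c * y + th)).
have := @is_deriveM R R (fun y => sin (c * y + th)) phi x 1 _ _ dsin (dphi x).
move=> dM; apply: is_derive_eq dM _.
by rewrite /j /GRing.scale/=; field; rewrite gt_eqF.
Qed.

Let int_j (c th : R) : mu.-integrable setT (EFin \o j c th).
Proof.
have -> : EFin \o j c th = ((fun x => c%:E * (cos (c * x + th) * phi x)%:E) \-
  (fun x => (s ^+ 2)^-1%:E * (x * sin (c * x + th) * phi x)%:E))%E.
  by apply/funext => x; rewrite /= /j EFinB !EFinM.
apply: integrableB => //; apply: integrableZl => //.
  by apply: int_phi; [exact: continuous_cos|exact: cos_max].
by apply: int_xphi; [exact: continuous_sin|exact: sin_max].
Qed.

(** As [G] is bounded by its peak [M], [phi_G] gives the decay [phi x <= M / |x|]. The sign [e]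
    handles both ends of the line. *)
Let J_cvg (c th : R) (e : R) : `|e| = 1 ->
  J c th (e * n.+1%:R) @[n --> \oo] --> (0 : R).
Proof.
move=> e1.
pose M := 2 * s * normal_peak s / normal_peak r * normal_peak r.
have phiM x : `|x| * phi x <= M.
  rewrite (le_trans (phi_G x))// /M /G ler_wpM2l ?normal_pdf_ub ?gt_eqF//.
  by rewrite divr_ge0 ?normal_peak_ge0// !mulr_ge0 ?normal_peak_ge0// ltW.
apply: norm_cvg0; apply: (@squeeze_cvgr _ _ _ _ (cst 0) (fun n => M * n.+1%:R^-1)).
- near=> n; rewrite normr_ge0/= /J normrM (ger0_norm (phi_ge0 _)).
  rewrite ler_pdivlMr// (le_trans _ (phiM (e * n.+1%:R)))// normrM e1 mul1r.
  by rewrite normr_nat mulrC ler_wpM2l// ler_piMl// sin_max.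
- exact: cvg_cst.
- by rewrite -(mulr0 M); apply: cvgM; [exact: cvg_cst|exact: cvg_harmonic].
Unshelve. all: by end_near. Qed.

Let continuous_j (c th : R) : continuous (j c th).
Proof.
move=> x; have carg : {for x, continuous (fun y : R => c * y + th)}.
  apply/differentiable_continuous/derivable1_diffP.
  by have [] := is_derive_arg c th x.
have cphi : {for x, continuous phi}.
  by apply: continuous_normal_pdf; rewrite gt_eqF.
apply: cvgB; (apply: cvgM; first exact: cvg_cst); apply: cvgM => //.
  by apply: (continuous_comp carg); exact: continuous_cos.
apply: cvgM; first exact: cvg_id.
by apply: (continuous_comp carg); exact: continuous_sin.
Qed.

(* [j] is the derivative of [J], which vanishes at infinity: this is the
   integration by parts turning F' into - s^2 c F. *)
Let integral_j (c th : R) : (\int[mu]_x (j c th x)%:E = 0)%E.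
Proof.
pose D n := `[- n.+1%:R, n.+1%:R]%classic : set R.
have lim0 : (\int[mu]_(x in D n) (j c th x)%:E @[n --> \oo] --> 0)%E.
  rewrite (_ : (fun n => _) = (fun n =>
      (J c th (1 * n.+1%:R) - J c th (- 1 * n.+1%:R))%:E)).
    apply: cvg_EFin; first by near=> n.
    by rewrite -(subr0 0); apply: cvgB; apply: J_cvg; rewrite ?normrN1 ?normr1.
  apply/funext => n; rewrite mul1r mulN1r EFinB.
  apply: continuous_FTC2.
  - by rewrite -subr_gt0 opprK addr_gt0.
  - by apply: continuous_subspaceT => x; exact: continuous_j.
  - have cJ x : {for x, continuous (J c th)}.
      apply/differentiable_continuous/derivable1_diffP.
      by have [] := dJ c th x.
    split; first by move=> x _; have [] := dJ c th x.
      exact/cvg_at_right_filter/cJ.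
    exact/cvg_at_left_filter/cJ.
  - by move=> x _; rewrite derive1E; have [] := dJ c th x.
suff : (\int[mu]_(x in D n) (j c th x)%:E @[n --> \oo] -->
    \int[mu]_x (j c th x)%:E)%E.
  by move=> /cvg_unique; apply.
have mj : measurable_fun setT (j c th).
  by apply: continuous_measurable_fun => x; exact: continuous_j.
under eq_fun do rewrite integral_mkcond.
have [] // := @dominated_convergence _ _ R mu setT measurableT
  (fun n => (EFin \o j c th) \_ (D n)) (EFin \o j c th)
  (abse \o (EFin \o j c th)) _ _ _ _ _.
- move=> n; apply/(measurable_restrictT _ _).1; first exact: measurable_itv.
  by apply: measurable_funTS; exact/measurable_EFinP.
- exact/measurable_EFinP.
- apply: aeW => x _; apply: cvg_near_cst; near=> n.
  rewrite patchE ifT// inE /D/= in_itv/= -ler_norml.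
  apply: (@le_trans _ _ n%:R); last by rewrite ler_nat.
  by near: n; exact: nbhs_infty_ger.
- exact: integrable_abse.
- apply: aeW => x n _; rewrite patchE; case: ifP => // _.
  by rewrite abse0 abse_ge0.
Unshelve. all: by end_near. Qed.

Let F (th c : R) := \int[mu]_x (cos (c * x + th) * phi x).

Let int_f (th c : R) :
  mu.-integrable setT (EFin \o (fun x => cos (c * x + th) * phi x)).
Proof. by apply: int_phi; [exact: continuous_cos|exact: cos_max]. Qed.

Let int_xsin (th c : R) :
  mu.-integrable setT (EFin \o (fun x => x * sin (c * x + th) * phi x)).
Proof. by apply: int_xphi; [exact: continuous_sin|exact: sin_max]. Qed.

Let xsinE (th c : R) :
  \int[mu]_x (x * sin (c * x + th) * phi x) = s ^+ 2 * c * F th c.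
Proof.
have intZ (k : R) (g : R -> R) : mu.-integrable setT (EFin \o g) ->
    mu.-integrable setT (EFin \o (fun x => k * g x)).
  move=> ig; rewrite (_ : EFin \o _ = (fun x => k%:E * (EFin \o g) x)%E).
    exact: integrableZl.
  by apply/funext => x /=; rewrite EFinM.
have : \int[mu]_x j c th x = 0 by rewrite /Rintegral integral_j.
rewrite /j RintegralB//=; [|exact/intZ/int_f|exact/intZ/int_xsin].
rewrite (RintegralZl _ measurableT (int_f th c)).
rewrite (RintegralZl _ measurableT (int_xsin th c)).
move=> /subr0_eq H; rewrite -mulrA /F H mulVKf//.
by rewrite expf_neq0// gt_eqF.
Qed.

(** Differentiation under the integral, with [G] dominating the derivative uniformly in [c]; [xsinE]
    then turns the result back into [F]. *)
Let dF (th c : R) : is_derive c 1 (F th) (- (s ^+ 2 * c * F th c)).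
Proof.
pose f (c x : R) := cos (c * x + th) * phi x.
have df (y x : R) : is_derive y 1 (f ^~ x) (- (x * sin (y * x + th) * phi x)).
  have darg : is_derive y 1 (fun y : R => y * x + th) x.
    rewrite (_ : (fun y : R => y * x + th) = (fun y : R => x * y + th)).
      exact: is_derive_arg.
    by apply/funext => z; rewrite mulrC.
  have dcos := @is_derive1_comp _ (@cos R) (fun y => y * x + th) y _ _
    (is_derive_cos _) darg.
  have := @is_deriveM R R _ (cst (phi x)) y 1 _ _ dcos (is_derive_cst _ _ _).
  move=> dM; apply: is_derive_eq dM _.
  by rewrite /GRing.scale/= mulr0 add0r; ring.
have d1f y x : partial1of2 f y x = - (x * sin (y * x + th) * phi x).
  by rewrite partial1of2E; have [] := df y x.
have Ic : `]c - 1, c + 1[%classic c.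
  by rewrite /= in_itv/= ltrBlDr !ltrDl ltr01.
have intf (y : R) : `]c - 1, c + 1[%classic y -> mu.-integrable setT (EFin \o f y).
  by move=> _; exact: int_f.
have derf (y x : R) : `]c - 1, c + 1[%classic y -> setT x ->
    derivable (f ^~ x) y 1.
  by move=> _ _; have [] := df y x.
have G_ub (y x : R) : `]c - 1, c + 1[%classic y -> setT x ->
    `|partial1of2 f y x| <= G x.
  move=> _ _; rewrite d1f normrN !normrM (ger0_norm (phi_ge0 x)).
  by rewrite (le_trans _ (phi_G x))// ler_wpM2r// ler_piMr// sin_max.
have dd := @derivable_under_integral R _ _ mu f setT measurableT c (c - 1) (c + 1)
  Ic intf derf G G_ge0 intG G_ub.
have dE := @differentiation_under_integral R _ _ mu f setT measurableT c (c - 1)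
  (c + 1) Ic intf derf G G_ge0 intG G_ub.
split; first exact: dd.
rewrite -derive1E.
move: dE; rewrite -xsinE => ->.
under eq_Rintegral do rewrite d1f -mulN1r.
by rewrite RintegralZl ?mulN1r//; exact: int_xsin.
Qed.

(** The equation [dF] is solved with the integrating factor [E]: the product [F th * E] has zero
    derivative, hence equals its value [cos th] at 0. *)
Lemma normal_fourier (c th : R) :
  \int[mu]_x (cos (c * x + th) * normal_pdf 0 s x) =
  expR (- (s ^+ 2 * c ^+ 2 / 2)) * cos th.
Proof.
pose E (c : R) := expR (s ^+ 2 * c ^+ 2 / 2).
have dE (x : R) : is_derive x 1 E (s ^+ 2 * x * E x).
  have -> : E = expR \o ((s ^+ 2 / 2) *: (id ^+ 2 : R -> R)).
    apply/funext => y; rewrite /E /=; congr expR.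
    by rewrite -[RHS]/(s ^+ 2 / 2 * (y * y)); field.
  apply: is_derive_eq.
  by rewrite /GRing.scale/= expr1; field.
have dFE (x : R) : is_derive x 1 (F th * E) 0.
  have := @is_deriveM R R (F th) E x 1 _ _ (dF th x) (dE x).
  move=> dM; apply: is_derive_eq dM _.
  by rewrite /GRing.scale/=; ring.
have F0 : F th 0 = cos th.
  rewrite /F; under eq_Rintegral do rewrite mul0r add0r.
  rewrite RintegralZl//; last exact: integrable_normal_pdf.
  by rewrite /Rintegral integral_normal_pdf mulr1.
have := is_derive_0_is_cst c 0 dFE.
rewrite -[LHS]/(F th c * E c) -[RHS]/(F th 0 * E 0) F0.
rewrite {2}/E expr0n/= mulr0 mul0r expR0 mulr1 => <-.
by rewrite /E expRN mulrC mulfK// gt_eqF// expR_gt0.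
Qed.

(** Change of variables by the Radon-Nikodym derivative, which is almost everywhere [normal_pdf]
    because both have the same integral over every measurable set. *)
Lemma integral_normal_prob (g : R -> R) :
  measurable_fun setT g -> (forall x, `|g x| <= 1) ->
  (\int[normal_prob 0 s]_x (g x)%:E =
   \int[mu]_x (g x * normal_pdf 0 s x)%:E)%E.
Proof.
move=> mg g1.
have dom := @normal_prob_dominates R 0 s.
have ig : (normal_prob 0 s).-integrable setT (EFin \o g).
  exact: (@integrable_bounded _ _ _ (normal_prob 0 s) g 1).
rewrite -(Radon_Nikodym_change_of_variables dom _ ig)//=.
apply: ae_eq_integral => //.
- apply: emeasurable_funM; first exact/measurable_EFinP.
  by apply: (measurable_int mu); exact: Radon_Nikodym_integrable.
- by apply/measurable_EFinP; apply: measurable_funM.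
rewrite (_ : (fun x => (g x * normal_pdf 0 s x)%:E) =
  (fun x => (g x)%:E * (normal_pdf 0 s x)%:E)%E); last first.
  by apply/funext => x; rewrite EFinM.
apply: ae_eqe_mul2l => /=.
rewrite Radon_NikodymE//=.
case: cid => /= h [h1 h2 h3].
apply: integral_ae_eq => //=; first exact/measurable_EFinP.
by move=> E _ mE; rewrite -h3.
Qed.

Lemma normal_char (c th : R) :
  (\int[normal_prob 0 s]_x (cos (c * x + th))%:E =
   (expR (- (s ^+ 2 * c ^+ 2 / 2)) * cos th)%:E)%E.
Proof.
rewrite (@integral_normal_prob (fun x => cos (c * x + th))).
- rewrite -normal_fourier /Rintegral fineK//.
  by apply: integrable_fin_num => //; exact: int_f.
- by apply: mtrig; exact: continuous_cos.
- by move=> x; exact: cos_max.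
Qed.

End normal_char.

(** * The cosine as a test function for the Wasserstein distance *)

Lemma cos_lipschitz (R : realType) (a b : R) : `|cos a - cos b| <= `|a - b|.
Proof.
wlog ab : a b / a <= b.
  move=> H; have [ab|ba] := leP a b; first exact: H.
  by rewrite distrC (distrC a) H// ltW.
have [x _ E] := @MVT_segment R (@cos R) (fun x => - sin x) a b ab
  (fun x _ => is_derive_cos x) (continuous_subspaceT (@continuous_cos R)).
rewrite distrC (distrC a) E.
by rewrite normrM normrN ler_piMl// sin_max.
Qed.

Lemma coord_le_enorm (R : realType) (d : nat) (i : 'I_d) (x : 'rV[R]_d) :
  `|x 0 i| <= enorm x.
Proof.
rewrite -sqrtr_sqr /enorm ler_wsqrtr// /dotp (bigD1 i)//= -expr2 lerDl.
by apply: sumr_ge0 => k _; rewrite -expr2 sqr_ge0.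
Qed.

Lemma W1_ge_cos (R : realType) (d : nat) (i : 'I_d)
    (mu nu : probability 'rV[R]_d R) (a b : R) :
  (\int[mu]_x (cos (x 0 i))%:E = a%:E)%E ->
  (\int[nu]_x (cos (x 0 i))%:E = b%:E)%E ->
  ((b - a)%:E <= W1 mu nu)%E.
Proof.
move=> mua nub.
have intN (m : probability 'rV[R]_d R) :
    (\int[m]_x (- cos (x 0 i))%:E = - \int[m]_x (cos (x 0 i))%:E)%E.
  rewrite -[RHS]mulN1e -EFinN -integralZl//.
    by apply: eq_integral => x _; rewrite -EFinM mulN1r.
  by apply: integrable_cos; exact: measurable_coord.
apply: ereal_sup_ubound; exists (fun x => - cos (x 0 i)) => /=.
  move=> x y; rewrite opprK addrC (le_trans (cos_lipschitz _ _))//.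
  by rewrite distrC (le_trans _ (coord_le_enorm i _))// !mxE.
by rewrite !intN mua nub -EFinN -EFinN -EFinB opprK addrC.
Qed.

(** * Cosine transforms of the increments of the two noises *)

Lemma stable_increment_char (dO : measure_display) (Om : measurableType dO)
    (R : realType) (P : probability Om R) (d : nat) (i : 'I_d) (alpha : R)
    (L : R -> Om -> 'rV[R]_d) : stable_levy_process P alpha L ->
  forall s t c, 0 <= s -> s < t -> 0 < c -> forall th,
  (\int[P]_w (cos (c * (L t w - L s w) 0 i + th))%:E =
   (expR (- ((t - s) * c `^ alpha / 2)) * cos th)%:E)%E.
Proof.
move=> [[mL _ _ L_stat _] L_char] s t c s0 st c0 th.
have ts0 : 0 <= t - s by rewrite subr_ge0 ltW.
have t0 : 0 <= t := le_trans s0 (ltW st).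
have mLi u : 0 <= u -> measurable_fun setT (fun w => L u w 0 i).
  by move=> u0; exact: (measurableT_comp (measurable_coord i) (mL u u0)).
have mU : measurable_fun setT (fun w => (L t w - L s w) 0 i).
  rewrite (_ : (fun w => _) = (fun w => L t w 0 i - L s w 0 i)).
    by apply: measurable_funB; exact: mLi.
  by apply/funext => w; rewrite !mxE.
have mg : measurable_fun setT (fun x : R => cos (c * x + th)).
  apply: measurableT_comp; first exact: measurable_cosr.
  by apply: measurable_funD => //; exact: measurable_funM.
(* The frequency [c] along axis [i], of Euclidean norm [c], reduces the vector transform to that of
   one coordinate. *)
pose xi : 'rV[R]_d := c *: delta_mx 0 i.
have dotE x : dotp xi x = c * x 0 i.
  rewrite /dotp (bigD1 i)//= big1 ?addr0 => [|k ki].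
    by rewrite !mxE !eqxx mulr1.
  by rewrite !mxE eqxx/= (negbTE ki) mulr0 mul0r.
have normE : enorm xi = c.
  by rewrite /enorm dotE !mxE !eqxx mulr1 -expr2 sqrtr_sqr gtr0_norm.
have [Ecos Esin] := L_char (t - s) xi ts0.
transitivity (\int[P]_w (cos (c * L (t - s) w 0 i + th))%:E)%E.
  apply: (@eq_law_integral _ _ _ _ R P P (fun w => (L t w - L s w) 0 i)
    (fun w => L (t - s) w 0 i) (fun x => cos (c * x + th))) => //.
  - exact: mLi.
  - by apply: integrable_cos; apply: measurable_funD => //; exact: measurable_funM.
  - apply: integrable_cos; apply: measurable_funD => //.
    by apply: measurable_funM => //; exact: mLi.
  move=> B mB; apply: (L_stat s t s0 (ltW st) [set v : 'rV[R]_d | B (v 0 i)]).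
  by rewrite -[X in measurable X]setTI; exact: (measurable_coord i).
move: Ecos Esin; rewrite unlock normE.
under eq_integral do rewrite dotE.
under [in X in _ -> X -> _]eq_integral do rewrite dotE.
move=> Ecos Esin.
have mcL : measurable_fun setT (fun w => c * L (t - s) w 0 i).
  by apply: measurable_funM => //; exact: mLi.
have icos := integrable_cos P mcL.
have isin : P.-integrable setT (fun w => (sin (c * L (t - s) w 0 i))%:E).
  apply: (@integrable_bounded _ _ _ P (fun w => sin (c * L (t - s) w 0 i)) 1).
    apply: measurableT_comp mcL.
    exact: (continuous_measurable_fun (@continuous_sin R)).
  by move=> w; exact: sin_max.
(* Addition formula for the cosine: the sine transform vanishes, leaving [cos th] times the cosine
   transform. *)
transitivity (\int[P]_w ((cos th)%:E * (cos (c * L (t - s) w 0 i))%:E -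
    (sin th)%:E * (sin (c * L (t - s) w 0 i))%:E))%E.
  by apply: eq_integral => w _; rewrite cosD -!EFinM -EFinB mulrC (mulrC (sin th)).
rewrite integralB//; [|exact: integrableZl|exact: integrableZl].
by rewrite !integralZl// Ecos Esin mule0 sube0 -EFinM mulrC.
Qed.

Lemma brownian_increment_char (dO : measure_display) (Om : measurableType dO)
    (R : realType) (P : probability Om R) (d : nat) (i : 'I_d)
    (B : R -> Om -> 'rV[R]_d) : brownian_motion P B ->
  forall s t c, 0 <= s -> s < t -> 0 < c -> forall th,
  (\int[P]_w (cos (c * (B t w - B s w) 0 i + th))%:E =
   (expR (- ((t - s) * c `^ 2 / 2)) * cos th)%:E)%E.
Proof.
move=> [mB _ _ B_gauss _] s t c s0 st c0 th.
have t0 : 0 <= t := le_trans s0 (ltW st).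
have mBi u : 0 <= u -> measurable_fun setT (fun w => B u w 0 i).
  by move=> u0; exact: (measurableT_comp (measurable_coord i) (mB u u0)).
have mU : measurable_fun setT (fun w => (B t w - B s w) 0 i).
  rewrite (_ : (fun w => _) = (fun w => B t w 0 i - B s w 0 i)).
    by apply: measurable_funB; exact: mBi.
  by apply/funext => w; rewrite !mxE.
have marg : measurable_fun setT (fun x : R => c * x + th).
  by apply: measurable_funD => //; exact: measurable_funM.
have sd0 : 0 < Num.sqrt (t - s) by rewrite sqrtr_gt0 subr_gt0.
have := normal_char sd0 c th.
rewrite sqr_sqrtr ?subr_ge0 ?ltW// powR_mulrn ?ltW// => <-.
apply: (@eq_law_integral _ _ _ _ R P (normal_prob 0 (Num.sqrt (t - s)))
  (fun w => (B t w - B s w) 0 i) id (fun x => cos (c * x + th))) => //.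
- by apply: measurableT_comp marg; exact: measurable_cosr.
- by apply: integrable_cos; apply: measurable_funD => //; exact: measurable_funM.
- exact: integrable_cos.
move=> A mA.
(* Leaving the other coordinates unconstrained extracts the marginal law of coordinate [i]. *)
pose A' (k : 'I_d) : set (measurableTypeR R) := if k == i then A else setT.
have := B_gauss s t s0 st A' _.
rewrite (bigD1 i)//= big1 => [|k ki]; last first.
  by rewrite /A' (negbTE ki) probability_setT.
rewrite mule1 (_ : A' i = A); last by rewrite /A' eqxx.
move=> <-.
  congr (P _); apply/seteqP; split => w /=.
    by move=> Aw k; rewrite /A'; case: eqP => [->|].
  by move=> /(_ i); rewrite /A' eqxx.
by move=> k; rewrite /A'; case: ifP.
Qed.

(** * The gap between the two limits, and the conclusion *)

Lemma expR_gap (R : realType) (alpha : R) : 1 < alpha -> alpha < 2 ->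
  expR (- 2^-1) / 8 * (2 - alpha) <=
  expR (- (1 / 2 / 2)) - expR (- (1 / alpha / 2)).
Proof.
move=> a1 a2.
have a0 : 0 < alpha by apply: lt_trans a1.
(* The difference of exponents is [(2 - alpha) / (4 * alpha)], and [alpha < 2] yields the 8. Below,
   [1 < alpha] yields the factor [expR (- 2^-1)], and [1 + u <= expR u] linearises the gap. *)
have gap : (2 - alpha) / 8 <= 1 / alpha / 2 - 1 / 2 / 2.
  have -> : 1 / alpha / 2 - 1 / 2 / 2 = (2 - alpha) / (4 * alpha).
    by field; rewrite gt_eqF.
  apply: ler_wpM2l; first by rewrite subr_ge0 ltW.
  by rewrite lef_pV2 ?posrE ?mulr_gt0//; lra.
have -> : expR (- (1 / 2 / 2)) =
    expR (- (1 / alpha / 2)) * expR (1 / alpha / 2 - 1 / 2 / 2).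
  by rewrite -expRD; congr expR; ring.
have le1 : expR (- 2^-1) <= expR (- (1 / alpha / 2)).
  rewrite ler_expR lerN2 -mulrA mul1r -invfM lef_pV2 ?posrE ?mulr_gt0//; lra.
rewrite -[X in _ <= _ - X]mulr1 -mulrBr -mulrA (mulrC _ (2 - alpha)).
apply: ler_pM; [exact: expR_ge0| |exact: le1|].
  by rewrite divr_ge0// subr_ge0 ltW.
by rewrite (le_trans gap)// lerBrDl expR_ge1Dx.
Qed.

Theorem proposition4p1 (R : realType) (d : nat) (hd : (1 <= d)%N) :
  exists2 C : R, 0 < C &
    forall (alpha : R), 1 < alpha -> alpha < 2 ->
    forall (dO : measure_display) (Om : measurableType dO)
      (P : probability Om R) (L : R -> Om -> 'rV[R]_d)
      (X : 'rV[R]_d -> R -> Om -> 'rV[R]_d) (mu_alpha : probability 'rV[R]_d R),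
    stable_levy_process P alpha L ->
    (forall x, ou_solution P L x (X x)) ->
    ergodic_measure P X mu_alpha ->
    forall (dO' : measure_display) (Om' : measurableType dO')
      (P' : probability Om' R) (B : R -> Om' -> 'rV[R]_d)
      (Y : 'rV[R]_d -> R -> Om' -> 'rV[R]_d) (mu_2 : probability 'rV[R]_d R),
    brownian_motion P' B ->
    (forall x, ou_solution P' B x (Y x)) ->
    ergodic_measure P' Y mu_2 ->
    ((C * (2 - alpha))%:E <= W1 mu_alpha mu_2)%E.
Proof.
exists (expR (- 2^-1) / 8); first by rewrite divr_gt0// expR_gt0.
move=> alpha a1 a2 dO Om P L X mu_alpha L_stable X_sol [mu_inv _].
move=> dO' Om' P' B Y mu_2 B_bm Y_sol [nu_inv _].
(* The assumption [1 <= d] provides the first coordinate, along which both laws are tested. *)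
pose i : 'I_d := Ordinal hd.
have [[mL L0 L_ind _ _] _] := L_stable.
have [mB B0 B_ind _ _] := B_bm.
have a0 : 0 < alpha := lt_trans ltr01 a1.
have cos_alpha := ou_invariant_cos a0 mL L0 L_ind
  (stable_increment_char i L_stable) X_sol mu_inv.
have cos_2 := ou_invariant_cos (ltr0n _ 2) mB B0 B_ind
  (brownian_increment_char i B_bm) Y_sol nu_inv.
by apply: le_trans (W1_ge_cos cos_alpha cos_2); rewrite lee_fin expR_gap.
Qed.
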